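(* Let $\mathcal{K}\hookrightarrow\mathcal{L}$ be simplicial complexes, where $\mathcal{L}$ is unweighted and $q$-non-branching. Then the up persistent Laplacian takes the form $$\Delta_{q,\mathrm{up}}^{\mathcal{K},\mathcal{L}}=B_{q+1}^{\mathcal{L},\mathcal{K}}\left(\mathrm{Id}_h\oplus S^{-1}\right)(B_{q+1}^{\mathcal{L},\mathcal{K}})^T,$$ which coincides with the hypergraph Laplacian of the weighted oriented hypergraph $\widetilde{\mathcal{K}}$.
   Context: Simplicial complexes are finite. $\mathcal{L}$ is $q$-non-branching if every $q$-simplex of $\mathcal{L}$ is a face of at most two $(q+1)$-simplices. Unweighted means that all simplices (of $\mathcal{L}$ and of its subcomplex $\mathcal{K}$) have weight $1$, so the oriented simplices form an orthonormal basis of the real chain spaces $C_p^{\mathcal{L}}$, $C_p^{\mathcal{K}}$. Let $C_{q+1}^{\mathcal{L},\mathcal{K}}=\{c\in C_{q+1}^{\mathcal{L}}:\partial_{q+1}^{\mathcal{L}}c\in C_q^{\mathcal{K}}\}$ with induced inner product and $\partial_{q+1}^{\mathcal{L},\mathcal{K}}:C_{q+1}^{\mathcal{L},\mathcal{K}}\to C_q^{\mathcal{K}}$ the restricted boundary operator. $\Delta_{q,\mathrm{up}}^{\mathcal{K},\mathcal{L}}$ is the matrix of $\partial_{q+1}^{\mathcal{L},\mathcal{K}}\circ(\partial_{q+1}^{\mathcal{L},\mathcal{K}})^*$ in the basis of oriented $q$-simplices of $\mathcal{K}$. Let $B_{q+1}^{\mathcal{L}}$ be the matrix of $\partial_{q+1}^{\mathcal{L}}$,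 $I_q^{\mathcal{K}}$ the row indices of $q$-simplices of $\mathcal{K}$, and $D$ the submatrix of $B_{q+1}^{\mathcal{L}}$ formed by the rows not in $I_q^{\mathcal{K}}$. Let $C_0$ be the set of indices of zero columns of $D$ (all columns if $D$ has no rows), $h=|C_0|$. On the remaining column indices form the graph in which two columns are adjacent if some row of $D$ is non-zero in both. A connected component $C$ is regulable if every non-zero row of $D(:,C)$ has exactly two non-zero entries and the columns of $D(:,C)$ can be multiplied by signs $\pm1$ so that every non-zero row has one entry $1$ and one entry $-1$. Let $C_1,\dots,C_r$ be the regulable components, $l_j=|C_j|$, $S=\mathrm{diag}(l_1,\dots,l_r)$, and let $\varepsilon_j\in\{\pm1\}^{C_j}$ be such a choice of signs. Put $b_j=B_{q+1}^{\mathcal{L}}(I_q^{\mathcal{K}},C_j)\varepsilon_j$; $B_{q+1}^{\mathcal{L},\mathcal{K}}$ is the concatenation of $B_{q+1}^{\mathcal{L}}(I_q^{\mathcal{K}},C_0)$ with the columns $b_1,\dots,b_r$. It is the matrix of $\partial_{q+1}^{\mathcal{L},\mathcal{K}}$ in a suitable basis of $C_{q+1}^{\mathcal{L},\mathcal{K}}$. An oriented hypergraph has a finite vertex set $V$ and a finite family $E$ of hyperedges $e=(e_{\mathrm{in}},e_{\mathrm{out}})$, pairs of disjoint (possibly empty) subsets of $V$; its incidence matrix $\mathcal{I}$ has entry $1$ if $v\in e_{\mathrm{in}}$, $-1$ if $v\in e_{\mathrm{out}}$, $0$ otherwise. With diagonal matrices $W_0$, $W_1$ of positive vertex and hyperedge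 weights, its Laplacian is $L_0=W_0\,\mathcal{I}\,W_1\,\mathcal{I}^T$. $\widetilde{\mathcal{K}}$ is the weighted oriented hypergraph obtained by interpreting $B_{q+1}^{\mathcal{L},\mathcal{K}}$ as an incidence matrix: its vertices are the $q$-simplices of $\mathcal{K}$ (all of weight $1$), its hyperedges correspond to the columns, i.e. to the boundaries of the connected polyhedra in $\mathcal{L}$ formed by the $(q+1)$-simplices making up each column (a single simplex for an index in $C_0$, the union of the simplices indexed by $C_j$ for $b_j$), and the hyperedge weights are given by the diagonal matrix $\mathrm{Id}_h\oplus S^{-1}$.
   Formalization: The coincidence with the hypergraph Laplacian is stated only when the persistent boundary matrix has all entries in {-1,0,1}, i.e. when the oriented hypergraph exists; it can have entries ±2 (projective plane with a non-contractible cycle). The matrix formula is unconditional. *)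

(* Defs.v *)
From HB Require Import structures.
From mathcomp Require Import all_boot all_order all_algebra.

Set Implicit Arguments.
Unset Strict Implicit.
Unset Printing Implicit Defensive.

Import Order.TTheory GRing.Theory Num.Theory.
Local Open Scope ring_scope.

(* Chains are real chains; nothing below needs more of the reals than an
   ordered field, so R is an arbitrary realFieldType. *)

Record complex (V : finType) := Complex {
  faces :> {set {set V}};
  complex_set0 : set0 \notin faces;
  complex_down : forall s t : {set V},
    s \in faces -> t \subset s -> t != set0 -> t \in faces
}.

Section Chains.
Variable V : finType.
Implicit Types (K L : complex V) (p q : nat) (s t : seq V).

Definition simplices L p : {set {set V}} := [set a in L | #|a| == p.+1].

Definition simplex L p (i : 'I_#|simplices L p|) : {set V} := enum_val i.

Definition subcomplex K L : bool := K \subset (L : {set {set V}}).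

Definition nonbranching L q : Prop :=
  forall a, a \in simplices L q ->
    (#|[set b in simplices L q.+1 | a \subset b]| <= 2)%N.

(* An orientation is given by a reference ordering o a of the vertices of each
   simplex a; only its class modulo even permutations matters. *)
Definition orients (o : {set V} -> seq V) L : Prop :=
  forall a, a \in L -> perm_eq (o a) (enum a).

(* Number of pairs of entries of s that occur in the opposite order in t: if
   s and t are orderings of the same set, its parity is the signature of the
   permutation taking s to t. *)
Definition inversions s t : nat :=
  #|[set xy : V * V | [&& xy.1 \in s, xy.2 \in s,
       (index xy.1 s < index xy.2 s)%N & (index xy.2 t < index xy.1 t)%N]]|.

Variables (R : realFieldType) (o : {set V} -> seq V).

(* The coordinates of a chain are its coefficients on the simplices L p, each
   with its reference orientation. *)
Definition chain L p := 'cV[R]_#|simplices L p|.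

(* The oriented simplex [v_0, ..., v_p], for s = [:: v_0; ...; v_p]. *)
Definition oriented L p s : chain L p :=
  \col_i (if simplex i == [set x in s]
          then (-1) ^+ inversions s (o (simplex i)) else 0).

Definition boundary_simplex L p s : chain L p :=
  \sum_(k < size s) (-1) ^+ k *: oriented L p (take k s ++ drop k.+1 s).

Definition boundary_mx L p : 'M[R]_(#|simplices L p|, #|simplices L p.+1|) :=
  \matrix_(i, j) boundary_simplex L p (o (simplex j)) i 0.

Definition boundary L p : 'Hom(chain L p.+1, chain L p) :=
  linfun (mulmx (boundary_mx L p)).

End Chains.

Arguments chain {V} R L p.

Section Adjoint.
Variable R : realFieldType.

Definition dot n (u v : 'cV[R]_n) : R := \sum_i u i 0 * v i 0.

Variables (m n : nat) (U : {vspace 'cV[R]_m}) (W : {vspace 'cV[R]_n}).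

Definition is_adjoint (f : 'Hom(subvs_of U, subvs_of W))
    (g : 'Hom(subvs_of W, subvs_of U)) : Prop :=
  forall u w, dot (vsval (f u)) (vsval w) = dot (vsval u) (vsval (g w)).

Lemma dotE k (u v : 'cV[R]_k) : dot u v = (u^T *m v) 0 0.
Proof. by rewrite mxE; apply: eq_bigr => i _; rewrite mxE. Qed.

Lemma dotuu_eq0 k (u : 'cV[R]_k) : dot u u = 0 -> u = 0.
Proof.
move/eqP; rewrite /dot psumr_eq0 => [/allP h|i _]; last exact: sqr_ge0.
apply/colP => i; rewrite mxE; apply/eqP.
by have := h i (mem_index_enum i); rewrite /= mulf_eq0 orbb.
Qed.

Lemma adjoint_sig (f : 'Hom(subvs_of U, subvs_of W)) : {g | is_adjoint f g}.
Proof.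
pose k := \dim U; pose b := vbasis U.
pose M : 'M[R]_(k, m) := \matrix_(i, j) b`_i j 0.
pose F : 'M[R]_(n, k) := \matrix_(i, j) vsval (f (vsproj U b`_j)) i 0.
have bU i : (i < k)%N -> b`_i \in U.
  by move=> ik; apply: vbasis_mem; apply: mem_nth; rewrite size_tuple.
have combM (c : 'cV_k) : M^T *m c = \sum_(i < k) c i 0 *: b`_i.
  apply/colP => i; rewrite mxE summxE; apply: eq_bigr => j _.
  by rewrite !mxE mulrC.
have combU c : M^T *m c \in U.
  by rewrite combM; apply: memv_suml => i _; rewrite memvZ// bU.
have combP u : u \in U -> exists c, u = M^T *m c.
  move=> /coord_vbasis e; exists (\col_i coord b i u); rewrite e combM.
  by apply: eq_bigr => i _; rewrite mxE -e.
have combF c : vsval (f (vsproj U (M^T *m c))) = F *m c.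
  rewrite combM !linear_sum /=; apply/colP => i; rewrite mxE summxE.
  by apply: eq_bigr => j _; rewrite !linearZ /= !mxE mulrC.
have Gunit : M *m M^T \in unitmx.
  rewrite -row_free_unit; apply/inj_row_free => v; rewrite mulmxA => vG.
  have z0 : M^T *m v^T = 0.
    apply: dotuu_eq0; rewrite dotE -trmx_mul trmxK trmx_mul mulmxA vG mul0mx.
    by rewrite mxE.
  apply/rowP => i; have := vbasisP U => /andP[_ /freeP fr].
  have := fr (fun i => v^T i 0); rewrite -combM => /(_ z0 i).
  by rewrite !mxE.
pose A := M^T *m (invmx (M *m M^T) *m F^T).
exists (linfun (vsproj U \o (mulmx A \o (vsval : subvs_of W -> _)))) => u w.
rewrite lfunE /= vsprojK; last by rewrite /A -mulmxA combU.
have [c cE] := combP _ (subvsP u).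
rewrite -{1}[u]vsvalK cE combF !dotE !trmx_mul trmxK /A !mulmxA.
by congr ((_ *m _) 0 0); rewrite -[_ *m M *m _]mulmxA mulmxK.
Qed.

Definition adjoint (f : 'Hom(subvs_of U, subvs_of W)) := sval (adjoint_sig f).

Lemma adjointP f : is_adjoint f (adjoint f).
Proof. exact: svalP (adjoint_sig f). Qed.

Lemma adjoint_uniq f g : is_adjoint f g -> g = adjoint f.
Proof.
move=> fg; apply/lfunP => w; apply/eqP; rewrite -subr_eq0; apply/eqP.
set d := _ - _; apply: val_inj; rewrite linear0; apply: dotuu_eq0.
have dE : vsval d = vsval (g w) - vsval (adjoint f w) by rewrite linearB.
rewrite -[X in dot _ X]/(vsval d) dE dotE mulmxBr mxE [X in _ + X]mxE -!dotE -(fg d w).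
by rewrite (adjointP f d w) subrr.
Qed.

End Adjoint.

Section PersistentLaplacian.
Variables (R : realFieldType) (V : finType) (o : {set V} -> seq V).
Variables (K L : complex V) (q : nat).

(* Row indices of the q-simplices of K. *)
Definition Krows : {set 'I_#|simplices L q|} := [set i | simplex i \in K].

(* The chains of K, as the subspace of chain R L q spanned by the oriented
   q-simplices of K. *)
Definition Kchains : {vspace chain R L q} :=
  (\sum_(i in Krows) <[delta_mx i 0%R]>)%VS.

Definition pers_chains : {vspace chain R L q.+1} :=
  (boundary R o L q @^-1: Kchains)%VS.

(* vsproj is the identity on the values it is applied to here. *)
Definition pers_boundary : 'Hom(subvs_of pers_chains, subvs_of Kchains) :=
  linfun (vsproj Kchains \o boundary R o L q \o vsval).

Definition up_laplacian : 'M[R]_#|Krows| :=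
  let f := (pers_boundary \o adjoint pers_boundary)%VF in
  \matrix_(i, j)
    vsval (f (vsproj Kchains (delta_mx (enum_val j) 0))) (enum_val i) 0.

Notation B := (boundary_mx R o L q).

Definition Dmx : 'M[R]_(#|~: Krows|, #|simplices L q.+1|) :=
  rowsub (@enum_val _ (mem (~: Krows))) B.

Definition zero_cols : {set 'I_#|simplices L q.+1|} :=
  [set j | col j Dmx == 0].

Definition col_adj : rel 'I_#|simplices L q.+1| :=
  fun j k => [&& j \notin zero_cols, k \notin zero_cols, j != k
               & [exists i, (Dmx i j != 0) && (Dmx i k != 0)]].

Definition components : {set {set 'I_#|simplices L q.+1|}} :=
  equivalence_partition (connect col_adj) (~: zero_cols).

Definition signs n (e : {ffun 'I_n -> bool}) : 'cV[R]_n :=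
  \col_k (-1) ^+ e k.

Definition regulates (C : {set 'I_#|simplices L q.+1|})
    (e : {ffun 'I_#|C| -> bool}) : bool :=
  let M := colsub (@enum_val _ (mem C)) Dmx in
  [forall i, (row i M != 0) ==>
     [&& #|[set k | M i k != 0]| == 2%N,
         #|[set k | M i k * signs e k 0 == 1]| == 1%N
       & #|[set k | M i k * signs e k 0 == -1]| == 1%N]].

Definition regulable (C : {set 'I_#|simplices L q.+1|}) : bool :=
  [exists e : {ffun 'I_#|C| -> bool}, regulates e].

Definition reg_components : {set {set 'I_#|simplices L q.+1|}} :=
  [set C in components | regulable C].

Definition reg_comp (j : 'I_#|reg_components|)
    : {set 'I_#|simplices L q.+1|} := enum_val j.

Definition Smx : 'M[R]_#|reg_components| :=
  diag_mx (\row_j (#|reg_comp j|%:R)).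

(* B (I_q^K, C) *)
Definition Bsub (C : {set 'I_#|simplices L q.+1|}) : 'M[R]_(#|Krows|, #|C|) :=
  mxsub (@enum_val _ (mem Krows)) (@enum_val _ (mem C)) B.

Definition pers_boundary_mx
    (e : forall j : 'I_#|reg_components|, {ffun 'I_#|reg_comp j| -> bool})
    : 'M[R]_(#|Krows|, #|zero_cols| + #|reg_components|) :=
  row_mx (Bsub zero_cols)
         (\matrix_(i, j) (Bsub (reg_comp j) *m signs (e j)) i 0).

Definition weight_mx : 'M[R]_(#|zero_cols| + #|reg_components|) :=
  block_mx 1%:M 0 0 (invmx Smx).

End PersistentLaplacian.

Arguments regulates R {V} o K L q {C} e.

Record oriented_hypergraph (n m : nat) := OrientedHypergraph {
  e_in : 'I_m -> {set 'I_n};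
  e_out : 'I_m -> {set 'I_n};
  e_disjoint : forall e, [disjoint e_in e & e_out e]
}.

Record weighted_hypergraph (R : realFieldType) (n m : nat) :=
  WeightedHypergraph {
  hgraph :> oriented_hypergraph n m;
  vweight : 'I_n -> R;
  eweight : 'I_m -> R;
  vweight_gt0 : forall v, 0 < vweight v;
  eweight_gt0 : forall e, 0 < eweight e
}.

Section Hypergraph.
Variables (R : realFieldType) (n m : nat).

Definition incidence (H : oriented_hypergraph n m) : 'M[R]_(n, m) :=
  \matrix_(v, e) if v \in e_in H e then 1
                 else if v \in e_out H e then -1 else 0.

Definition hlaplacian (H : weighted_hypergraph R n m) : 'M[R]_n :=
  diag_mx (\row_v vweight H v) *m incidence H
    *m diag_mx (\row_e eweight H e) *m (incidence H)^T.

Lemma interp_disjoint (M : 'M[R]_(n, m)) e :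
  [disjoint [set v | M v e == 1] & [set v | M v e == -1]].
Proof.
rewrite disjoints_subset; apply/subsetP => v; rewrite !inE => /eqP ->.
by rewrite -subr_eq0 opprK -(natrD R 1 1) pnatr_eq0.
Qed.

(* The hypergraph obtained by interpreting M as an incidence matrix. Its
   incidence matrix is M exactly when M has entries in {-1, 0, 1}, see
   incidence_interp. *)
Definition interp_hypergraph (M : 'M[R]_(n, m)) : oriented_hypergraph n m :=
  OrientedHypergraph (interp_disjoint M).

Definition incidence_like (M : 'M[R]_(n, m)) : Prop :=
  forall v e, M v e \in [:: -1; 0; 1].

Lemma incidence_interp M :
  incidence (interp_hypergraph M) = M <-> incidence_like M.
Proof.
split=> [<- v e|h].
  by rewrite mxE; case: ifP => _; [|case: ifP => _]; rewrite !inE eqxx ?orbT.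
apply/matrixP => v e; rewrite mxE !inE.
have := h v e; rewrite !inE; case: (M v e =P 1) => [->//|_].
by case: (M v e =P -1) => [->//|_]; rewrite orbF /= => /eqP ->.
Qed.

End Hypergraph.

Section Ktilde.
Variables (R : realFieldType) (V : finType) (o : {set V} -> seq V).
Variables (K L : complex V) (q : nat).
Notation r := #|reg_components R o K L q|.
Notation h := #|zero_cols R o K L q|.
Notation W := (weight_mx R o K L q).

Lemma weight_gt0 e : 0 < W e e.
Proof.
have Ngt0 j : 0 < #|@reg_comp R V o K L q j|%:R :> R.
  rewrite ltr0n card_gt0; apply/set0Pn.
  have := enum_valP j; rewrite inE => /andP[/imsetP[x xD xE] _].
  by exists x; rewrite /reg_comp xE inE xD connect0.
pose d : 'rV[R]_r := \row_j #|@reg_comp R V o K L q j|%:R.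
have Sinv : invmx (Smx R o K L q) = diag_mx (\row_j (d 0 j)^-1).
  have SV : Smx R o K L q *m diag_mx (\row_j (d 0 j)^-1) = 1%:M.
    rewrite mul_diag_mx; apply/matrixP => i j; rewrite !mxE.
    case: eqP => [->|_]; last by rewrite mulr0n mulr0.
    by rewrite mulr1n mulfV // gt_eqF.
  by have [Su _] := mulmx1_unit SV; rewrite -[RHS](mulKmx Su) SV mulmx1.
rewrite /weight_mx Sinv -[e]splitK; case: split => i /=.
  by rewrite block_mxEul mxE eqxx ltr01.
by rewrite block_mxEdr !mxE eqxx mulr1n invr_gt0.
Qed.

(* pers_boundary_mx can have entries 2 or -2: if L triangulates the real
   projective plane and K is a non-contractible cycle in it, then the triangles
   form one regulable component, whose boundary is twice K. So there is an
   oriented hypergraph with this incidence matrix only when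
   incidence_like (pers_boundary_mx e) holds. *)
Definition Ktilde
    (e : forall j : 'I_r, {ffun 'I_#|reg_comp j| -> bool})
    : weighted_hypergraph R #|Krows K L q| (h + r) :=
  @WeightedHypergraph R _ _
    (interp_hypergraph (pers_boundary_mx e)) (fun=> 1) (fun i => W i i)
    (fun=> ltr01) weight_gt0.

End Ktilde.

(* Main.v *)
Require Import Defs.
From mathcomp Require Import all_boot all_order all_algebra.

Set Implicit Arguments.
Unset Strict Implicit.
Unset Printing Implicit Defensive.

Import Order.TTheory GRing.Theory Num.Theory.
Local Open Scope ring_scope.

(** Let D be the rows of the boundary matrix B outside K, and B_K the rows in
    K.  A chain lies in [pers_chains] exactly when D kills it, so the adjoint of
    the restricted boundary operator is the transpose of B_K followed by the
    orthogonal projection P onto ker D, and the up Laplacian is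
    B_K P B_K^T ([up_laplacianE]).

    The projection is explicit because non-branching makes D look like the
    incidence matrix of a signed graph: its entries are 0 or of absolute value
    1, and each row has at most two non-zero entries ([Dmx_norm],
    [Dmx_row_le2]).  The equation of a row with two non-zero entries therefore
    forces a vector u in ker D to have equal absolute values at the two
    adjacent columns, and so |u| is constant on every connected component C
    ([kernel_norm]).  If this constant is non-zero, the signs of u on C
    cancel every row of D, that is, they regulate C ([kernel_regulable]);
    hence u vanishes on the components that are not regulable.  On a regulable
    component with signs eps, the product u * eps is constant
    ([kernel_prod]), so u is there a multiple of the signed indicator vector
    of C.  On zero columns u is arbitrary.

    Thus ker D is spanned by the unit vectors of the zero columns and the
    signed indicator vectors of the regulable components.  These have disjoint
    supports and squared norms 1 and |C|.  If Z is the matrix with these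
    columns ([kernel_mx]), then P = Z W Z^T with W the given weights
    ([kernel_mx_proj]), and B_K Z is [pers_boundary_mx], which is the formula.
    The hypergraph Laplacian is the same product, since W is diagonal. *)

(** * Entries of the boundary matrix *)

Section BoundaryEntries.
Variables (R : realFieldType) (V : finType) (o : {set V} -> seq V).
Variables (L : complex V) (q : nat).

Lemma mem_simplex p (i : 'I_#|simplices L p|) : simplex i \in simplices L p.
Proof. exact: enum_valP. Qed.

Lemma set_omit_nth (s : seq V) (k : 'I_(size s)) x0 : uniq s ->
  [set x in take k s ++ drop k.+1 s] = [set x in s] :\ nth x0 s k.
Proof.
move=> us; apply/setP => x; rewrite !inE.
have := remE (nth x0 s k) s; rewrite index_uniq // => <-.
by rewrite mem_rem_uniq // !inE.
Qed.

Hypothesis oL : orients o L.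
Notation B := (boundary_mx R o L q).

(** The omitted vertex can be recovered from the remaining ones, so at most one
    of the signed terms that make up an entry is non-zero. *)
Lemma boundary_mx_entry i j :
  B i j = 0 \/ simplex i \subset simplex j /\ `|B i j| = 1.
Proof.
rewrite mxE /boundary_simplex summxE; set s := o _.
have /setIdP[jL _] := mem_simplex j.
have sj : perm_eq s (enum (simplex j)) by apply: oL.
have us : uniq s by rewrite (perm_uniq sj) enum_uniq.
have sE : [set x in s] = simplex j.
  by apply/setP => x; rewrite inE (perm_mem sj) mem_enum.
case: (pickP (fun k : 'I_(size s) =>
    simplex i == [set x in take k s ++ drop k.+1 s])) => [k /eqP ik|no]; last first.
  by left; apply: big1 => k _; rewrite !mxE no mulr0.
have x0 : V by case: (s) k {ik} => [[]|].
right; split.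
  by rewrite ik (set_omit_nth _ x0) // sE subD1set.
rewrite (bigD1 k) //= big1 => [|l lk].
  by rewrite addr0 !mxE ik eqxx normrM !normrX !normrN1 !expr1n mulr1.
rewrite !mxE ik; case: ifP => [/eqP|_]; last by rewrite mulr0.
rewrite !(set_omit_nth _ x0) // => /setP/(_ (nth x0 s l)).
rewrite !inE eqxx mem_nth //= andbT nth_uniq // => /negbT; rewrite negbK.
by move/eqP/ord_inj => e; rewrite e eqxx in lk.
Qed.

End BoundaryEntries.

(** * The signed graph on the columns of D *)

Section KernelD.
Variables (R : realFieldType) (V : finType) (o : {set V} -> seq V).
Variables (K L : complex V) (q : nat).
Hypotheses (oL : orients o L) (Lq : nonbranching L q).

Notation B := (boundary_mx R o L q).
Notation D := (Dmx R o K L q).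
Notation n := #|simplices L q.+1|.
Notation adj := (@col_adj R V o K L q).
Notation C0 := (zero_cols R o K L q).
Implicit Types (C : {set 'I_n}) (u z : 'cV[R]_n).

Lemma Dmx_norm i j : D i j != 0 -> `|D i j| = 1.
Proof. by rewrite mxE; have [->|[]//] := boundary_mx_entry R oL (enum_val i) j; rewrite eqxx. Qed.

(** This is where non-branching enters: the columns in which a row of D is
    non-zero are cofaces of the q-simplex indexing that row. *)
Lemma Dmx_row_le2 i j k l : D i j != 0 -> D i k != 0 -> D i l != 0 -> j != k ->
  l = j \/ l = k.
Proof.
have face m : D i m != 0 -> simplex (enum_val i) \subset simplex m.
  by rewrite mxE; have [->|[]//] := boundary_mx_entry R oL (enum_val i) m; rewrite eqxx.
move=> /face ij /face ik /face il jk.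
case: (eqVneq l j) => [|lj]; first by left.
case: (eqVneq l k) => [|lk]; first by right.
have := Lq (mem_simplex (enum_val i)); rewrite leqNgt => /negP[].
have inj : injective (@simplex V L q.+1) by apply: enum_val_inj.
apply: (leq_trans (n := #|[set simplex m | m in [set l; j; k]]|)).
  by rewrite card_imset // -setUA cardsU1 cards2 jk !inE (negbTE lj) (negbTE lk).
apply/subset_leq_card/subsetP => _ /imsetP[m mM ->]; rewrite inE mem_simplex /=.
by move: mM; rewrite !inE -orbA => /or3P[] /eqP ->.
Qed.

Lemma zero_colsP j : reflect (forall i, D i j = 0) (j \in C0).
Proof.
rewrite inE; apply: (iffP eqP) => [/colP h i|h].
  by have := h i; rewrite !mxE.
by apply/colP => i; rewrite mxE h mxE.
Qed.

Lemma Dmx_row_pair u i j k : D i j != 0 -> D i k != 0 -> j != k ->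
  (D *m u) i 0 = D i j * u j 0 + D i k * u k 0.
Proof.
move=> ij ik jk; rewrite mxE (bigD1 j) // (bigD1 k) 1?eq_sym //=.
rewrite big1 ?addr0 // => l /andP[lj lk].
case: (eqVneq (D i l) 0) => [->|il]; first by rewrite mul0r.
by case: (Dmx_row_le2 ij ik il jk) => e; rewrite e eqxx in lj lk.
Qed.

Lemma col_adjP j k : adj j k -> exists i, [/\ D i j != 0, D i k != 0 & j != k].
Proof. by case/and4P => _ _ jk /existsP[i /andP[ij ik]]; exists i. Qed.

Lemma col_adj_intro i j k : D i j != 0 -> D i k != 0 -> j != k -> adj j k.
Proof.
move=> ij ik jk; apply/and4P; split=> //.
- by apply/zero_colsP => /(_ i)/eqP; rewrite (negbTE ij).
- by apply/zero_colsP => /(_ i)/eqP; rewrite (negbTE ik).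
by apply/existsP; exists i; rewrite ij.
Qed.

Lemma col_adj_sym : connect_sym adj.
Proof.
apply: sym_connect_sym => j k.
apply/idP/idP => /col_adjP[i [ij ik jk]]; apply: (col_adj_intro (i := i)) => //; by rewrite eq_sym.
Qed.

Lemma connect_col_adj_equiv : {in ~: C0 & &, equivalence_rel (connect adj)}.
Proof.
move=> x y z _ _ _; split=> [|xy]; first exact: connect0.
exact: (same_connect col_adj_sym).
Qed.

Lemma partition_components : partition (components R o K L q) (~: C0).
Proof. exact: equivalence_partitionP connect_col_adj_equiv. Qed.

Lemma eq_component C D' j : C \in components R o K L q ->
  D' \in components R o K L q -> j \in C -> j \in D' -> C = D'.
Proof.
move=> Cc Dc jC jD; have /and3P[_ tI _] := partition_components.
by rewrite -(def_pblock tI Cc jC) (def_pblock tI Dc jD).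
Qed.

Lemma component_connect C j k : C \in components R o K L q ->
  j \in C -> (k \in C) = connect adj j k.
Proof.
case/imsetP => x xN ->; rewrite inE [k \in _]inE !in_setC => /andP[jN xj].
rewrite (same_connect col_adj_sym xj); apply/andP/idP => [[]//|jk].
split=> //; have /connectP[p pP ->] := jk.
elim: p j jN {xj jk} pP => //= a p IH j jN /andP[ja pP]; apply: IH pP.
by have /and4P[] := ja.
Qed.

(** A component is connected, so constancy only has to be checked across edges.
    It is applied below to |u| and to the product of two kernel vectors. *)
Lemma component_const (T : Type) (f : 'I_n -> T) C : C \in components R o K L q ->
  (forall j k, adj j k -> f j = f k) -> {in C &, forall j k, f j = f k}.
Proof.
move=> Cc fadj j k jC; rewrite (component_connect k Cc jC) => /connectP[p pP ->].
by elim: p j pP {jC} => //= a p IH j /andP[/fadj-> /IH].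
Qed.

(** * Signed indicator vectors *)

(** Right multiplication by [incl C] selects the columns in C; left
    multiplication extends a vector indexed by C by zero. *)
Definition incl C : 'M[R]_(n, #|C|) := colsub (@enum_val _ (mem C)) 1%:M.
Definition signed_indicator C (e : {ffun 'I_#|C| -> bool}) : 'cV[R]_n :=
  incl C *m signs R e.

Lemma mul_incl m (M : 'M[R]_(m, n)) C :
  M *m incl C = colsub (@enum_val _ (mem C)) M.
Proof. by rewrite mulmx_colsub mulmx1. Qed.

Lemma signed_indicator_in C (e : {ffun 'I_#|C| -> bool}) a :
  signed_indicator e (enum_val a) 0 = (-1) ^+ e a.
Proof.
rewrite mxE (bigD1 a) //= big1 ?addr0 => [|b ba].
  by rewrite !mxE eqxx mul1r.
by rewrite !mxE (inj_eq enum_val_inj) eq_sym (negbTE ba) mul0r.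
Qed.

Lemma signed_indicator_out C (e : {ffun 'I_#|C| -> bool}) j :
  j \notin C -> signed_indicator e j 0 = 0.
Proof.
move=> jC; rewrite mxE big1 // => a _; rewrite !mxE.
case: eqP => [e'|_]; last by rewrite mul0r.
by rewrite e' enum_valP in jC.
Qed.

Lemma signed_indicator_sqr C (e : {ffun 'I_#|C| -> bool}) j :
  j \in C -> signed_indicator e j 0 ^+ 2 = 1.
Proof.
by move=> jC; rewrite -(enum_rankK_in jC jC) signed_indicator_in sqrr_sign.
Qed.

(** A row that meets C meets it in two columns, where after the change of signs
    it is 1 and -1; it therefore cancels the signs. *)
Lemma regulates_kernel C (e : {ffun 'I_#|C| -> bool}) :
  regulates R o K L q e -> D *m signed_indicator e = 0.
Proof.
rewrite /signed_indicator mulmxA mul_incl => /forallP reg.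
set M := colsub _ _ in reg *; apply/colP => i; rewrite [RHS]mxE.
have := reg i; case: (eqVneq (row i M) 0) => [r0 _|_ /and3P[/cards2P[a [b [ab Eab]]]]].
  have := congr1 (fun x => (x *m signs R e) 0 0) r0.
  by rewrite -row_mul mul0mx !mxE.
have supp x : x != 0 -> {subset [set k | M i k * signs R e k 0 == x] <= [set a; b]}.
  move=> x0 k; rewrite -Eab !inE => /eqP kx; apply: contraNneq x0 => Mk.
  by rewrite -kx Mk mul0r.
case/cards1P => p Ep /cards1P[m Em].
have Mp : M i p * signs R e p 0 = 1.
  by apply/eqP; have := set11 p; rewrite -Ep inE.
have Mm : M i m * signs R e m 0 = -1.
  by apply/eqP; have := set11 m; rewrite -Em inE.
have pab : p \in [set a; b] by apply: (supp 1); rewrite ?oner_eq0 // Ep set11.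
have mab : m \in [set a; b] by apply: (supp (-1)); rewrite ?oppr_eq0 ?oner_eq0 // Em set11.
have pm : p != m.
  by apply: contra_eq_neq Mp => ->; rewrite Mm eq_sym -subr_eq0 opprK -(natrD R 1 1) pnatr_eq0.
rewrite mxE (bigD1 p) // (bigD1 m) 1?eq_sym //= Mp Mm addrA subrr add0r.
apply: big1 => k /andP[kp km]; case: (eqVneq (M i k) 0) => [->|Mk]; first by rewrite mul0r.
have kab : k \in [set a; b] by rewrite -Eab inE.
move: pab mab kab kp km pm; rewrite !inE.
by do 3![case/orP=> /eqP->]; rewrite ?eqxx.
Qed.

(** * The kernel of D on one component *)

(** The row that makes j and k adjacent has no third non-zero entry, and its two
    entries have absolute value 1. *)
Lemma kernel_norm u j k : D *m u = 0 -> adj j k -> `|u j 0| = `|u k 0|.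
Proof.
move=> Du /col_adjP[i [ij ik jk]].
have := Dmx_row_pair u ij ik jk; rewrite Du mxE => /esym/eqP.
rewrite addr_eq0 => /eqP/(congr1 Num.norm).
by rewrite normrN !normrM !Dmx_norm // !mul1r.
Qed.

(** If a row is (a, b) with a^2 = b^2 = 1, both u and z satisfy
    a u_j = - b u_k; multiplying the two equations removes the signs. *)
Lemma kernel_prod u z j k : D *m u = 0 -> D *m z = 0 -> adj j k ->
  u j 0 * z j 0 = u k 0 * z k 0.
Proof.
move=> Du Dz /col_adjP[i [ij ik jk]].
have uE := Dmx_row_pair u ij ik jk; have zE := Dmx_row_pair z ij ik jk.
rewrite Du mxE in uE; rewrite Dz mxE in zE.
move/esym/eqP: uE; rewrite addr_eq0 => /eqP uE.
move/esym/eqP: zE; rewrite addr_eq0 => /eqP zE.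
have sq m : D i m != 0 -> D i m ^+ 2 = 1.
  by move=> /Dmx_norm im; rewrite -real_normK ?num_real // im expr1n.
rewrite -[LHS]mul1r -(sq _ ij) -[RHS]mul1r -(sq _ ik) !expr2 !(mulrACA _ (D i _)).
by rewrite uE zE mulrNN.
Qed.

(** The regulating signs are those of u.  As |u| is constant on C, the equation
    of a row meeting C becomes a cancellation of two signed entries of D. *)
Lemma kernel_regulable C u : C \in components R o K L q -> D *m u = 0 ->
  (forall j, j \in C -> u j 0 != 0) -> regulable R o K C.
Proof.
move=> Cc Du u0; apply/existsP.
pose e := [ffun a : 'I_#|C| => u (enum_val a) 0 < 0].
exists e; rewrite /regulates; set M := colsub _ _.
apply/forallP => i; apply/implyP => /rV0Pn[a]; rewrite mxE => Ma.
have ME b : M i b = D i (enum_val b) by rewrite mxE.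
clearbody M.
have Mnorm b : `|M i b * signs R e b 0| = `|M i b|.
  by rewrite normrM [signs _ _ _ _]mxE normr_sign mulr1.
have uE b : u (enum_val b) 0 = signs R e b 0 * `|u (enum_val b) 0|.
  by rewrite mxE ffunE -realEsign ?num_real.
(* The non-zero entry of the row at a has to be cancelled by another one, and
   that column is adjacent to a, hence in C. *)
have [b [ab Mb]] : exists b, a != b /\ M i b != 0.
  have := congr1 (fun x : 'cV__ => x i 0) Du; rewrite !mxE (bigD1 (enum_val a)) //=.
  move=> s0.
  case: (pickP (fun k => (k != enum_val a) && (D i k != 0))) => [k /andP[ka ik]|no].
    have kC : k \in C.
      rewrite (component_connect k Cc (enum_valP a)); apply: connect1.
      by apply: (col_adj_intro (i := i)) => //; rewrite -?ME // eq_sym.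
    exists (enum_rank_in kC k); rewrite ME enum_rankK_in //; split=> //.
    by apply: contraNneq ka => ->; rewrite enum_rankK_in.
  move: s0; rewrite big1 => [/eqP|k ka]; last first.
    by have := no k; rewrite ka => /= /negbFE/eqP ->; rewrite mul0r.
  by rewrite addr0 mulf_eq0 -ME (negbTE Ma) (negbTE (u0 _ (enum_valP a))).
have only c : M i c != 0 -> c = a \/ c = b.
  rewrite !ME in Ma Mb * => Mc.
  by case: (Dmx_row_le2 Ma Mb Mc) => [|/enum_val_inj|/enum_val_inj];
    rewrite ?(inj_eq enum_val_inj); auto.
pose x c := M i c * signs R e c 0.
have x0 c : c != a -> c != b -> x c = 0.
  move=> ca cb; rewrite /x; case: (eqVneq (M i c) 0) => [->|/only[]cE]; first by rewrite mul0r.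
    by rewrite cE eqxx in ca.
  by rewrite cE eqxx in cb.
have xab : x a = - x b.
  have ab' : enum_val a != enum_val b by rewrite (inj_eq enum_val_inj).
  rewrite !ME in Ma Mb.
  have := Dmx_row_pair u Ma Mb ab'; rewrite Du mxE (uE a) (uE b) -!ME !mulrA.
  rewrite (@component_const _ (fun k => `|u k 0|) C Cc _ (enum_val a) (enum_val b)) ?enum_valP //.
    move/esym/eqP; rewrite -mulrDl mulf_eq0 normr_eq0 (negbTE (u0 _ (enum_valP b))) orbF.
    by rewrite addr_eq0 => /eqP.
  by move=> j k; apply: kernel_norm.
have xa : (x a == 1) || (x a == -1).
  by rewrite -sqrf_eq1 -real_normK ?num_real // Mnorm ME Dmx_norm -?ME // expr1n.
have n11 : (1 == -1 :> R) = false by rewrite -subr_eq0 opprK -(natrD R 1 1) pnatr_eq0.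
have single c d y : c != d -> x c = y -> x d = - y -> y != 0 -> y != - y ->
    (forall k, k != c -> k != d -> x k = 0) -> [set k | x k == y] = [set c].
  move=> cd xc xd y0 yy oth; apply/setP => k; rewrite !inE.
  case: (eqVneq k c) => [->|kc]; first by rewrite xc eqxx.
  case: (eqVneq k d) => [->|kd]; first by rewrite xd eq_sym (negbTE yy).
  by rewrite oth // eq_sym (negbTE y0).
have ba : b != a by rewrite eq_sym.
have x0' c : c != b -> c != a -> x c = 0 by move=> cb ca; apply: x0.
have xba : x b = - x a by rewrite xab opprK.
have y1 : 1 != 0 :> R := oner_neq0 R.
have y1N : -1 != 0 :> R by rewrite oppr_eq0.
apply/and3P; split.
- suff -> : [set k | M i k != 0] = [set a; b] by rewrite cards2 ab.
  apply/setP => k; rewrite !inE; apply/idP/orP => [/only[]->|[]/eqP->//];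
    by rewrite eqxx; auto.
- apply/cards1P; case/orP: xa => /eqP xa.
    by exists a; apply: (single a b) => //; rewrite ?xba ?xa ?n11.
  by exists b; apply: (single b a) => //; rewrite ?xba ?xa ?opprK ?n11.
apply/cards1P; case/orP: xa => /eqP xa.
  by exists b; apply: (single b a) => //; rewrite ?xba ?xa ?opprK // eq_sym n11.
by exists a; apply: (single a b) => //; rewrite ?xba ?xa ?opprK // eq_sym n11.
Qed.

(** * The orthogonal projection onto the kernel of D *)

Variable eps : forall j : 'I_#|reg_components R o K L q|,
  {ffun 'I_#|reg_comp j| -> bool}.
Hypothesis epsP : forall j, regulates R o K L q (eps j).

Notation W := (weight_mx R o K L q).
Notation r := #|reg_components R o K L q|.

Definition regulating_mx : 'M[R]_(n, r) :=
  \matrix_(i, j) signed_indicator (eps j) i 0.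
(** Its columns form an orthogonal basis of ker D, and the diagonal of the
    inverse of the weight matrix lists their squared norms. *)
Definition kernel_mx : 'M[R]_(n, #|C0| + r) := row_mx (incl C0) regulating_mx.

Lemma reg_compP (j : 'I_r) :
  reg_comp j \in components R o K L q /\ regulable R o K (reg_comp j).
Proof. by have := enum_valP j; rewrite inE => /andP. Qed.

Lemma pers_boundary_mxE :
  pers_boundary_mx eps = rowsub (@enum_val _ (mem (Krows K L q))) B *m kernel_mx.
Proof.
rewrite mul_mx_row mul_incl; congr row_mx; first by apply/matrixP => i j; rewrite !mxE.
apply/matrixP => i j; rewrite !mxE.
transitivity ((rowsub (@enum_val _ (mem (Krows K L q))) B
                 *m signed_indicator (eps j)) i 0).
  rewrite /signed_indicator mulmxA mul_incl !mxE; apply: eq_bigr => k _.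
  by rewrite !mxE.
by rewrite mxE; apply: eq_bigr => k _; rewrite [regulating_mx _ _]mxE.
Qed.

Lemma Dmx_kernel_mx : D *m kernel_mx = 0.
Proof.
rewrite mul_mx_row mul_incl -[RHS]row_mx0; congr row_mx; apply/matrixP => i j.
  by rewrite [LHS]mxE [RHS]mxE; have /zero_colsP-> := enum_valP j.
transitivity ((D *m signed_indicator (eps j)) i 0).
  by rewrite [LHS]mxE [RHS]mxE; apply: eq_bigr => k _; rewrite [regulating_mx _ _]mxE.
by rewrite regulates_kernel // !mxE.
Qed.

Lemma invmx_Smx : invmx (Smx R o K L q) = diag_mx (\row_j (#|reg_comp j|%:R)^-1).
Proof.
have SV : Smx R o K L q *m diag_mx (\row_j (#|reg_comp j|%:R)^-1) = 1%:M.
  rewrite mul_diag_mx; apply/matrixP => i j; rewrite !mxE.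
  case: eqP => [->|_]; last by rewrite mulr0n mulr0.
  rewrite mulr1n mulfV // pnatr_eq0 -lt0n card_gt0.
  have [jc _] := reg_compP j; have /and3P[_ _] := partition_components.
  by apply: contraNneq => <-.
by have [Su _] := mulmx1_unit SV; rewrite -[RHS](mulKmx Su) SV mulmx1.
Qed.

Lemma weight_mx_diag : W = diag_mx (\row_e W e e).
Proof.
apply/matrixP => i j; rewrite [RHS]mxE [(\row__ _) _ _]mxE.
case: (eqVneq i j) => [->|]; first by rewrite mulr1n.
rewrite mulr0n /weight_mx invmx_Smx.
rewrite -[i]splitK -[j]splitK.
case: (split i) => a; case: (split j) => b /= ab.
- by rewrite block_mxEul mxE; have [e|_] := eqVneq a b; rewrite ?mulr0n //; rewrite e eqxx in ab.
- by rewrite block_mxEur mxE.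
- by rewrite block_mxEdl mxE.
by rewrite block_mxEdr !mxE; have [e|_] := eqVneq a b; rewrite ?mulr0n //; rewrite e eqxx in ab.
Qed.

(** Coordinate k of the left-hand side only sees the column of [kernel_mx] whose
    support contains k.  For a regulable component C this gives eps_k times the
    mean over C of u * eps, which is u_k because u * eps is constant on C.  On
    the other components no column is available, but there u vanishes. *)
Lemma kernel_mx_proj u : D *m u = 0 -> kernel_mx *m W *m kernel_mx^T *m u = u.
Proof.
move=> Du; rewrite /kernel_mx /weight_mx mul_row_block !mulmx0 addr0 add0r mulmx1.
rewrite tr_row_mx mul_row_col mulmxDl invmx_Smx -!mulmxA.
have regE k : (regulating_mx *m (diag_mx (\row_j (#|reg_comp j|%:R)^-1)
      *m (regulating_mx^T *m u))) k 0 =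
    \sum_j signed_indicator (eps j) k 0 * (#|reg_comp j|%:R^-1 *
       \sum_(l in reg_comp j) u l 0 * signed_indicator (eps j) l 0).
  rewrite mxE; apply: eq_bigr => j _; rewrite [regulating_mx _ _]mxE; congr (_ * _).
  rewrite mul_diag_mx [LHS]mxE [(\row__ _) _ _]mxE; congr (_ * _).
  rewrite [LHS]mxE [RHS]big_mkcond /=; apply: eq_bigr => l _.
  rewrite [_^T _ _]mxE [regulating_mx _ _]mxE mulrC.
  by case: ifPn => // lj; rewrite signed_indicator_out ?mulr0.
have zeroE k : (incl C0 *m ((incl C0)^T *m u)) k 0 = if k \in C0 then u k 0 else 0.
  rewrite mxE; case: ifPn => kC.
    rewrite (bigD1 (enum_rank_in kC k)) //= big1 ?addr0 => [|a ak].
      rewrite !mxE enum_rankK_in // eqxx mul1r (bigD1 k) //= big1 ?addr0 => [|l lk].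
        by rewrite !mxE enum_rankK_in // eqxx mul1r.
      by rewrite !mxE enum_rankK_in // (negbTE lk) mul0r.
    rewrite !mxE; case: eqP => [kE|]; last by rewrite mul0r.
    by case/eqP: ak; apply: enum_val_inj; rewrite enum_rankK_in.
  apply: big1 => a _; rewrite !mxE; case: eqP => [kE|]; last by rewrite mul0r.
  by rewrite kE enum_valP in kC.
apply/colP => k; rewrite mxE zeroE regE.
have comp0 (j : 'I_r) : k \in C0 -> k \notin reg_comp j.
  move=> k0; have [jc _] := reg_compP j; have /and3P[/eqP cov _ _] := partition_components.
  apply: contraL k0 => kj; rewrite -in_setC -cov; apply/bigcupP; by exists (reg_comp j).
case: ifPn => k0.
  by rewrite big1 ?addr0 // => j _; rewrite signed_indicator_out ?mul0r ?comp0.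
have /and3P[/eqP cov _ _] := partition_components.
have : k \in cover (components R o K L q) by rewrite cov in_setC.
case/bigcupP => C Cc kC; rewrite add0r.
case: (boolP (regulable R o K C)) => Creg; last first.
  have uk0 : u k 0 = 0.
    apply/eqP; apply: contraNT Creg => uk; apply: (kernel_regulable Cc Du) => l lC.
    rewrite -normr_eq0 (@component_const _ (fun l => `|u l 0|) C Cc _ l k) ?normr_eq0 //.
    by move=> ? ?; apply: kernel_norm.
  rewrite uk0 big1 // => j _; rewrite signed_indicator_out ?mul0r //.
  have [jc jr] := reg_compP j; apply: contraNN Creg => kj.
  by rewrite (eq_component Cc jc kC kj).
have Cr : C \in reg_components R o K L q by rewrite inE Cc.
pose j := enum_rank_in Cr C.
have jE : reg_comp j = C by rewrite /reg_comp enum_rankK_in.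
rewrite (bigD1 j) //= [X in _ + X]big1 ?addr0 => [|i ij]; last first.
  rewrite signed_indicator_out ?mul0r //; apply: contraNN ij => ki.
  have [ic _] := reg_compP i; apply/eqP/enum_val_inj.
  by rewrite -/(reg_comp i) -/(reg_comp j) jE; apply: eq_component ki kC.
have kj : k \in reg_comp j by rewrite jE.
have [jc _] := reg_compP j.
rewrite (eq_bigr (fun=> u k 0 * signed_indicator (eps j) k 0)) => [|l lj]; last first.
  apply: (@component_const _ (fun l => u l 0 * signed_indicator (eps j) l 0) _ jc) => //.
  by move=> ? ?; apply: kernel_prod => //; apply: regulates_kernel.
rewrite sumr_const -[X in _ * (_ * X)]mulr_natl mulKf; last first.
  by rewrite pnatr_eq0 -lt0n card_gt0; apply/set0Pn; exists k.
by rewrite mulrCA -expr2 signed_indicator_sqr // mulr1.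
Qed.

(** * The persistent Laplacian *)

Lemma KchainsP (c : chain R L q) :
  reflect (forall i, i \notin Krows K L q -> c i 0 = 0) (c \in Kchains R K L q).
Proof.
apply: (iffP idP) => [|c0].
  case/memv_sumP => f fv -> i iK; rewrite summxE big1 // => l lK.
  have /vlineP[x ->] := fv l lK; rewrite !mxE.
  by case: eqP iK => [->|]; rewrite ?lK // mulr0.
have -> : c = \sum_(i in Krows K L q) c i 0 *: delta_mx i 0.
  rewrite [LHS]matrix_sum_delta [RHS]big_mkcond /=; apply: eq_bigr => i _.
  rewrite big_ord1; case: ifPn => // /c0 ->; exact: scale0r.
by apply: memv_sumr => i _; rewrite memvZ // memv_line.
Qed.

Lemma pers_chainsP u : reflect (D *m u = 0) (u \in pers_chains R o K L q).
Proof.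
rewrite -memv_preim lfunE /= mul_rowsub_mx.
apply: (iffP (KchainsP _)) => [h|/colP h i iK].
  apply/colP => i; rewrite [LHS]mxE h ?mxE //.
  by have := enum_valP i; rewrite inE.
rewrite -in_setC in iK.
have e := h (enum_rank_in iK i).
by rewrite [LHS]mxE [RHS]mxE enum_rankK_in in e.
Qed.

(** The adjoint is identified by [adjoint_uniq]: since P is symmetric and fixes
    [pers_chains], P B^T satisfies the adjunction identity. *)
Lemma up_laplacianE : up_laplacian R o K L q
  = pers_boundary_mx eps *m W *m (pers_boundary_mx eps)^T.
Proof.
pose P := kernel_mx *m W *m kernel_mx^T.
have Psym : P^T = P.
  by rewrite /P !trmx_mul trmxK mulmxA weight_mx_diag tr_diag_mx.
have PU v : P *m v \in pers_chains R o K L q.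
  by apply/pers_chainsP; rewrite /P !mulmxA Dmx_kernel_mx !mul0mx.
pose g : 'Hom(subvs_of (Kchains R K L q), subvs_of (pers_chains R o K L q)) :=
  linfun (vsproj _ \o (mulmx (P *m B^T) \o vsval)).
have gE w : vsval (g w) = P *m (B^T *m vsval w).
  by rewrite lfunE /= vsprojK -mulmxA.
have fE c : vsval (pers_boundary R o K L q c) = B *m vsval c.
  have cK : boundary R o L q (vsval c) \in Kchains R K L q.
    by rewrite memv_preim subvsP.
  by rewrite lfunE /= vsprojK // lfunE.
rewrite /up_laplacian; have <- : g = adjoint (pers_boundary R o K L q).
  apply: adjoint_uniq => c w; rewrite gE fE !dotE.
  have /pers_chainsP/kernel_mx_proj Pu := subvsP c.
  have cP : (vsval c)^T = (vsval c)^T *m P by rewrite -[in LHS]Pu (trmx_mul P) Psym.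
  by rewrite (trmx_mul B) {1}cP !mulmxA.
apply/matrixP => i j; rewrite mxE comp_lfunE fE gE vsprojK; last first.
  apply/KchainsP => k kK; rewrite mxE; case: eqP kK => // ->.
  by rewrite enum_valP.
have -> : pers_boundary_mx eps *m W *m (pers_boundary_mx eps)^T =
    mxsub (@enum_val _ (mem (Krows K L q))) (@enum_val _ (mem (Krows K L q)))
      (B *m P *m B^T).
  by rewrite pers_boundary_mxE trmx_mul mxsub_mul -mul_rowsub_mx -trmx_mxsub /P !mulmxA.
by rewrite !mulmxA -colE !mxE.
Qed.

End KernelD.

Theorem proposition4p2 (R : realFieldType) (V : finType) (K L : complex V)
    (o : {set V} -> seq V) (q : nat)
    (KL : subcomplex K L) (oL : orients o L) (Lq : nonbranching L q)
    (eps : forall j : 'I_#|reg_components R o K L q|,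
           {ffun 'I_#|reg_comp j| -> bool})
    (epsP : forall j, regulates R o K L q (eps j)) :
  up_laplacian R o K L q
    = pers_boundary_mx eps *m weight_mx R o K L q *m (pers_boundary_mx eps)^T
  /\ (incidence_like (pers_boundary_mx eps) ->
      incidence R (Ktilde eps) = pers_boundary_mx eps
      /\ up_laplacian R o K L q = hlaplacian (Ktilde eps)).
Proof.
have upE := up_laplacianE oL Lq epsP.
split=> // /incidence_interp inc; split=> //.
rewrite upE /hlaplacian inc -weight_mx_diag //=.
have -> : diag_mx (\row_v vweight (Ktilde eps) v) = 1%:M.
  by apply/matrixP => i j; rewrite !mxE.
by rewrite mul1mx.
Qed.
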